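(* For $k\ge 3$, $I_k$ is the ideal of $2\times 2$ minors of the $2\times 3$ matrix $$\begin{pmatrix} S(\overline w_{k-1})\\ \overline v_k\end{pmatrix}$$ over $R_k$; i.e. $V(I_k)$ is the preimage, under the map $$(\overline v_1,\dots,\overline v_k)\mapsto\begin{pmatrix} S(\overline w_{k-1}(\overline v_1,\dots,\overline v_{k-1}))\\ \overline v_k\end{pmatrix},$$ of the determinantal variety of $2\times 3$ matrices of rank $\le 1$. For $k=2$ the same statement holds with $S(\overline w_{k-1})$ replaced by $\overline v_1$.
   Context: $\mathbb F$ is a field of characteristic $\neq 2$, with fixed algebraic closure $\overline{\mathbb F}$. For $k\ge 2$, $R_k$ is the polynomial ring over $\mathbb F$ in the $3k$ variables $v_{i,c}$ ($1\le i\le k$, $c=1,2,3$), and $\overline v_i=(v_{i,1},v_{i,2},v_{i,3})\in R_k^3$. Let $S=\mathrm{diag}(-1,-1,1)$ and let $a\times b=(a_2b_3-a_3b_2,\;a_3b_1-a_1b_3,\;a_1b_2-a_2b_1)$ be the cross product. Define recursively $\overline w_2=\overline v_1\times\overline v_2$ and $\overline w_j=S(\overline w_{j-1})\times\overline v_j$ for $j\ge 3$. $I_k\subset R_k$ is the ideal generated by the three components of $\overline w_k$. In matrices, the vectors are written as rows of length 3. $V(I_k)$ is the vanishing locus of $I_k$ in $\mathbb A^{3k}(\overline{\mathbb F})$. *)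

(* Defs.v *)
From mathcomp Require Export all_boot all_order all_algebra.
From mathcomp Require Export mpoly.

Set Implicit Arguments.
Unset Strict Implicit.
Unset Printing Implicit Defensive.

Import GRing.Theory.
Local Open Scope ring_scope.

Section Vectors.
Variable R : comNzRingType.
Implicit Types (a b : 'rV[R]_3) (v : nat -> 'rV[R]_3).

Definition cross a b : 'rV[R]_3 :=
  \row_c [:: a 0 1 * b 0 2 - a 0 2 * b 0 1;
             a 0 2 * b 0 0 - a 0 0 * b 0 2;
             a 0 0 * b 0 1 - a 0 1 * b 0 0]`_c.

Definition Smx : 'M[R]_3 := diag_mx (\row_c [:: -1; -1; 1]`_c).

(* Vectors are rows, so S acts by multiplication on the right. *)
Definition Sact a : 'rV[R]_3 := a *m Smx.

(* The vectors are numbered from 1; the values at j = 0, 1 are junk. *)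
Fixpoint wvec v (j : nat) : 'rV[R]_3 :=
  match j with
  | 0 | 1 => 0
  | 2 => cross (v 1%N) (v 2%N)
  | i.+1 => cross (Sact (wvec v i)) (v i.+1)
  end.

(* [nth_row M i] is the i-th row of M in 1-based numbering; it is meant for
   1 <= i <= k only. *)
Definition nth_row k (M : 'M[R]_(k, 3)) (i : nat) : 'rV[R]_3 :=
  if insub i.-1 is Some o then row o M else 0.

End Vectors.

Section Ideals.
Variable R : comNzRingType.

Definition ideal_gen (G : R -> Prop) (p : R) : Prop :=
  exists s : seq (R * R),
    {in s, forall x, G x.2} /\ p = \sum_(x <- s) x.1 * x.2.

Definition is_minor t m n (A : 'M[R]_(m, n)) (d : R) : Prop :=
  exists (f : 'I_t -> 'I_m) (g : 'I_t -> 'I_n),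
    [/\ forall i j : 'I_t, (i < j)%N -> (f i < f j)%N,
        forall i j : 'I_t, (i < j)%N -> (g i < g j)%N
      & d = \det (mxsub f g A)].

Definition minors_ideal t m n (A : 'M[R]_(m, n)) : R -> Prop :=
  ideal_gen (is_minor t A).

End Ideals.

Section Polynomials.
Variable F : fieldType.

(* The variable v_{i,c} is the one of index [mxvec_index i c]. *)
Definition generic_mx k : 'M[{mpoly F[k * 3]}]_(k, 3) :=
  \matrix_(i < k, c < 3) 'X_(mxvec_index i c).

Definition vbar k : nat -> 'rV[{mpoly F[k * 3]}]_3 := nth_row (generic_mx k).

Definition Iw k : {mpoly F[k * 3]} -> Prop :=
  ideal_gen (fun g => exists c : 'I_3, g = wvec (vbar k) k 0 c).

(* Common zeros in affine n-space over the extension iota : F -> L. *)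
Definition vanishing (L : fieldType) (iota : {rmorphism F -> L}) n
    (I : {mpoly F[n]} -> Prop) (x : 'rV[L]_n) : Prop :=
  forall p, I p -> mmap iota (x 0) p = 0.

End Polynomials.

(* The k vectors of length 3 that make up a point of affine 3k-space, in the
   order of variables fixed by [generic_mx]. *)
Definition point_vec (L : fieldType) k (x : 'rV[L]_(k * 3)) :
  nat -> 'rV[L]_3 := nth_row (vec_mx x).

Definition determinantal (L : fieldType) m n r (A : 'M[L]_(m, n)) : Prop :=
  (\rank A <= r)%N.

(* Main.v *)
Require Import Defs.
From mathcomp Require Import ring.

Set Implicit Arguments.
Unset Strict Implicit.
Unset Printing Implicit Defensive.

Import GRing.Theory.
Local Open Scope ring_scope.

(** Up to sign, the three components of [cross a b] are the three 2 x 2 minors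
    of the matrix with rows [a] and [b]: both rows must be selected, in order,
    so a minor amounts to a choice of two columns, and only the middle component
    of the cross product takes its two columns in the reverse order.  Hence both
    families generate the same ideal ([cross_ideal_minors]).  As [wvec v k] is by
    definition the cross product of the two rows in question, this settles the
    ideals.

    For the loci, an ideal vanishes at a point as soon as its generators do
    ([vanishing_ideal_gen]).  Evaluation at a point is a ring morphism, and the
    recursion defining [wvec] uses only ring operations, so evaluating the
    components of [wvec] on the generic vectors amounts to running the recursion
    on the vectors of the point ([map_wvec], [eval_vbar]).  It remains that two
    vectors over a field have zero cross product exactly when they are linearly
    dependent, that is, when the matrix they form has rank at most 1
    ([cross_eq0_rank]). *)

Section IdealGen.
Variable R : comNzRingType.
Implicit Types (G H : R -> Prop) (p q : R).

Lemma ideal_gen0 G : ideal_gen G 0.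
Proof. by exists [::]; rewrite big_nil. Qed.

Lemma ideal_genD G p q : ideal_gen G p -> ideal_gen G q -> ideal_gen G (p + q).
Proof.
move=> [s [Gs ->]] [t [Gt ->]]; exists (s ++ t); rewrite big_cat; split=> // x.
by rewrite mem_cat => /orP[/Gs|/Gt].
Qed.

Lemma ideal_genM G p q : ideal_gen G q -> ideal_gen G (p * q).
Proof.
move=> [s [Gs ->]]; exists [seq (p * x.1, x.2) | x <- s]; split.
  by move=> _ /mapP[x /Gs Gx ->].
by rewrite big_map mulr_sumr; apply: eq_bigr => x _; rewrite mulrA.
Qed.

Lemma mem_ideal_gen G p : G p -> ideal_gen G p.
Proof.
move=> Gp; exists [:: (1, p)]; rewrite big_seq1 mul1r; split=> // x.
by rewrite inE => /eqP->.
Qed.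

Lemma ideal_gen_sub G H :
  (forall g, G g -> ideal_gen H g) -> forall p, ideal_gen G p -> ideal_gen H p.
Proof.
move=> GH p [s [Gs ->]]; rewrite big_seq.
apply: (big_ind (ideal_gen H)) => [|q r|x /Gs/GH]; first exact: ideal_gen0.
  exact: ideal_genD.
exact: ideal_genM.
Qed.

End IdealGen.

Lemma ord3P (i : 'I_3) : [\/ i = 0, i = 1 | i = 2].
Proof.
case: i => [[|[|[|//]]] ?];
  [apply: Or31 | apply: Or32 | apply: Or33]; exact: val_inj.
Qed.

Section CrossMinors.
Variable R : comNzRingType.
Implicit Types (a b : 'rV[R]_3).

(** The matrix has only two rows, so a strictly increasing selection [f] of two
    of them is the identity: the minor depends on the columns [g] alone. *)
Lemma det_mxsub_col_mx n (a b : 'rV[R]_n) (f : 'I_2 -> 'I_(1 + 1))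
    (g : 'I_2 -> 'I_n) :
    (forall i j : 'I_2, (i < j)%N -> (f i < f j)%N) ->
  \det (mxsub f g (col_mx a b))
    = a 0 (g 0) * b 0 (g 1) - a 0 (g 1) * b 0 (g 0).
Proof.
move=> /(_ 0 1 isT) f01.
have f0 : f 0 = unsplit (inl 0).
  apply/val_inj/eqP; rewrite -leqn0 -ltnS.
  exact: leq_trans f01 (ltn_ord (f 1)).
have f1 : f 1 = unsplit (inr 0).
  apply/val_inj/eqP; rewrite eqn_leq -ltnS (ltn_ord (f 1)) /=.
  exact: leq_ltn_trans (leq0n _) f01.
rewrite (expand_det_row _ 0) !big_ord_recl big_ord0 /cofactor !det_mx11 !mxE /=.
have -> : lift 0 0 = 1 :> 'I_2 by apply: val_inj.
have -> : lift 1 0 = 0 :> 'I_2 by apply: val_inj.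
rewrite f0 f1 !unsplitK -[ord0]/(0 : 'I_2) /= expr0 expr1; ring.
Qed.

Lemma is_minor_col_mx n (a b : 'rV[R]_n) (c d : 'I_n) : (c < d)%N ->
  is_minor 2 (col_mx a b) (a 0 c * b 0 d - a 0 d * b 0 c).
Proof.
move=> cd; exists id, (fun i : 'I_2 => if i == 0 then c else d); split=> //.
  by case=> [[|[|//]] ?] [[|[|//]] ?].
by rewrite det_mxsub_col_mx.
Qed.

(** Each generator of one ideal is a generator of the other up to sign, the sign
    being [-1] precisely for the pair of columns 0 and 2. *)
Lemma cross_ideal_minors a b p :
  ideal_gen (fun g => exists c : 'I_3, g = cross a b 0 c) p
    <-> minors_ideal 2 (col_mx a b) p.
Proof.
split; apply: ideal_gen_sub => {p}.
  move=> _ [c ->]; rewrite mxE; case: (ord3P c) => -> /=.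
  - by apply/mem_ideal_gen/is_minor_col_mx.
  - rewrite -opprB -mulN1r.
    by apply/ideal_genM/mem_ideal_gen/is_minor_col_mx.
  - by apply/mem_ideal_gen/is_minor_col_mx.
move=> _ [f [g [f_mono /(_ 0 1 isT) g01 ->]]]; rewrite det_mxsub_col_mx //.
have crossP c : ideal_gen (fun g => exists c, g = cross a b 0 c) (cross a b 0 c).
  by apply: mem_ideal_gen; exists c.
case: (ord3P (g 0)) (ord3P (g 1)) g01 => -> [] -> // _.
- by move: (crossP 2); rewrite mxE.
- by move: (crossP 1) => /(ideal_genM (-1)); rewrite mxE mulN1r opprB.
- by move: (crossP 0); rewrite mxE.
Qed.

End CrossMinors.

Section CrossRank.
Variable L : fieldType.

(** If [a] is nonzero, it already has rank 1, so the rank is at most 1 exactly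
    when [b] lies on the line spanned by [a]; the factor can be read off at any
    nonzero coordinate of [a]. *)
Lemma rank_col_mx_le1 n (a b : 'rV[L]_n) :
  (\rank (col_mx a b) <= 1)%N
    <-> forall i j, a 0 i * b 0 j = a 0 j * b 0 i.
Proof.
have [->|a_neq0] := eqVneq a 0.
  split=> [_ i j|_]; first by rewrite !mxE !mul0r.
  by rewrite -addsmxE adds0mx rank_leq_row.
have a_rank : \rank a = 1%N by rewrite rank_rV a_neq0.
split=> [rank1|proportional].
  have sub : (a <= col_mx a b)%MS by rewrite -addsmxE addsmxSl.
  have : (col_mx a b <= a)%MS.
    rewrite -(mxrank_leqif_sup sub) a_rank eqn_leq rank1 -{1}a_rank.
    by rewrite (mxrankS sub).
  rewrite col_mx_sub => /andP[_ /sub_rVP[t ->]] i j; rewrite !mxE; ring.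
have [i ai_neq0] : exists i, a 0 i != 0 by apply/rV0Pn.
rewrite -[leqRHS]a_rank; apply: mxrankS; rewrite col_mx_sub submx_refl /=.
apply/sub_rVP; exists (b 0 i / a 0 i); apply/rowP => j.
by rewrite mxE mulrAC -[b 0 i * _]mulrC -proportional mulrAC divff // mul1r.
Qed.

Lemma cross_eq0_rank (a b : 'rV[L]_3) :
  (forall c, cross a b 0 c = 0) <-> determinantal 1 (col_mx a b).
Proof.
rewrite /determinantal rank_col_mx_le1; split=> [cross0|proportional c].
  have := cross0 0; have := cross0 1; have := cross0 2.
  rewrite !mxE /= => /subr0_eq e01 /subr0_eq e20 /subr0_eq e12 i j.
  by case: (ord3P i) (ord3P j) => -> [] ->.
by rewrite mxE; case: (ord3P c) => -> /=; rewrite proportional subrr.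
Qed.

End CrossRank.

Section Evaluation.

Section Morphism.
Variables (R R' : comNzRingType) (phi : {rmorphism R -> R'}).

Lemma map_cross (a b : 'rV[R]_3) :
  map_mx phi (cross a b) = cross (map_mx phi a) (map_mx phi b).
Proof.
apply/rowP => c; rewrite !mxE.
by case: (ord3P c) => -> /=; rewrite rmorphB !rmorphM.
Qed.

Lemma map_Sact (a : 'rV[R]_3) : map_mx phi (Sact a) = Sact (map_mx phi a).
Proof.
rewrite /Sact map_mxM map_diag_mx; congr (_ *m diag_mx _).
by apply/rowP => c; rewrite !mxE; case: (ord3P c) => ->;
  rewrite /= ?rmorphN rmorph1.
Qed.

(** Stated with [v'] given by a pointwise equation, since equality of the
    functions themselves would need extensionality. *)
Lemma map_wvec (v : nat -> 'rV[R]_3) (v' : nat -> 'rV[R']_3) j :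
  (forall i, map_mx phi (v i) = v' i) -> map_mx phi (wvec v j) = wvec v' j.
Proof.
move=> vv'; elim: j => [|[|[|j] IHj]]; rewrite /= ?map_mx0 //.
  by rewrite map_cross !vv'.
by rewrite map_cross map_Sact vv' IHj.
Qed.

End Morphism.

Variables (F L : fieldType) (iota : {rmorphism F -> L}).

Lemma vanishing_ideal_gen n (G : {mpoly F[n]} -> Prop) (x : 'rV[L]_n) :
  vanishing iota (ideal_gen G) x <-> forall g, G g -> mmap iota (x 0) g = 0.
Proof.
split=> [van g Gg|van _ [s [Gs ->]]]; first by apply/van/mem_ideal_gen.
rewrite rmorph_sum big_seq big1 // => y /Gs/van y0.
by rewrite rmorphM /= y0 mulr0.
Qed.

Lemma eval_vbar k (x : 'rV[L]_(k * 3)) i :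
  map_mx (mmap iota (x 0)) (vbar F k i) = point_vec x i.
Proof.
rewrite /vbar /point_vec /nth_row; case: insub => [o|]; last exact: map_mx0.
by apply/rowP => c; rewrite !mxE mmapX mmap1U.
Qed.

Lemma vanishing_Iw k (x : 'rV[L]_(k * 3)) :
  vanishing iota (@Iw F k) x <-> forall c, wvec (point_vec x) k 0 c = 0.
Proof.
have evalE c : mmap iota (x 0) (wvec (vbar F k) k 0 c)
                 = wvec (point_vec x) k 0 c.
  by rewrite -(map_wvec k (eval_vbar x)) mxE.
rewrite /Iw vanishing_ideal_gen; split=> [van c|w0 _ [c ->]].
  by rewrite -evalE; apply: van; exists c.
by rewrite evalE.
Qed.

End Evaluation.

Theorem theorem6 (F : fieldType) (Fbar : closedFieldType)
    (iota : {rmorphism F -> Fbar})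
    (charF : 2%N \notin [pchar F])
    (algFbar : forall z : Fbar, algebraicOver iota z) :
  (forall k : nat, (3 <= k)%N ->
     (forall p : {mpoly F[k * 3]},
        Iw p <->
        minors_ideal 2 (col_mx (Sact (wvec (vbar F k) k.-1)) (vbar F k k)) p)
     /\
     (forall x : 'rV[Fbar]_(k * 3),
        vanishing iota (@Iw F k) x <->
        determinantal 1 (col_mx (Sact (wvec (point_vec x) k.-1))
                                (point_vec x k))))
  /\
  ((forall p : {mpoly F[2 * 3]},
      Iw p <-> minors_ideal 2 (col_mx (vbar F 2 1) (vbar F 2 2)) p)
   /\
   (forall x : 'rV[Fbar]_(2 * 3),
      vanishing iota (@Iw F 2) x <->
      determinantal 1 (col_mx (point_vec x 1) (point_vec x 2)))).
Proof.
split=> [[|[|[|k]]] // _|]; split=> [p|x].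
- exact: cross_ideal_minors.
- by rewrite vanishing_Iw -cross_eq0_rank.
- exact: cross_ideal_minors.
- by rewrite vanishing_Iw -cross_eq0_rank.
Qed.
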